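(* For positive integers $s,t,n$, we have $r_2(K_s,P^t_n) < (2s)^{t(t+1)\log n}$.
   Context: For ordered graphs $G,H$ (graphs on vertex set $\{1,\dots,m\}$ with the natural order), $r_2(G,H)$ is the minimum $N$ such that every red/blue coloring of the pairs of $[N]=\{1,\dots,N\}$ contains a red copy of $G$ or a blue copy of $H$, copies being order-preserving embeddings sending edges to edges. $K_s$ is the complete graph on $s$ vertices. The $t$-th power of the path $P_n^t$ is the ordered graph on $\{1,\dots,n\}$ in which $\{i,j\}$ is an edge iff $0<|i-j|\le t$. Logarithms are base $2$.
   Formalization: The theorem is proved for n ≥ 2 instead of all positive n: for n = 1 the strict inequality fails for all s and t, since r_2(K_s, P^t_1) = 1 and (2s)^{t(t+1) log 1} = 1. *)

(* Defs.v *)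
From HB Require Import structures.
From mathcomp Require Import all_boot all_order all_algebra.
From mathcomp Require Import all_classical all_reals all_analysis.

Set Implicit Arguments.
Unset Strict Implicit.
Unset Printing Implicit Defensive.

Local Open Scope nat_scope.

(* The vertex set {1,..,m} is represented by 'I_m = {0,..,m-1}, with the order
   of the underlying naturals. *)
Record ordered_graph := OrderedGraph {
  order_of : nat;
  adj : rel 'I_order_of;
  adj_sym : symmetric adj;
  adj_irr : irreflexive adj }.

Definition complete_adj (s : nat) : rel 'I_s := fun i j => i != j.

Lemma complete_adj_sym s : symmetric (@complete_adj s).
Proof. by move=> i j; rewrite /complete_adj eq_sym. Qed.

Lemma complete_adj_irr s : irreflexive (@complete_adj s).
Proof. by move=> i; rewrite /complete_adj eqxx. Qed.

Definition complete (s : nat) : ordered_graph :=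
  OrderedGraph (@complete_adj_sym s) (@complete_adj_irr s).

Definition path_power_adj (t n : nat) : rel 'I_n :=
  fun i j => (0 < `|i - j|%N <= t)%N.

Lemma path_power_adj_sym t n : symmetric (@path_power_adj t n).
Proof. by move=> i j; rewrite /path_power_adj distnC. Qed.

Lemma path_power_adj_irr t n : irreflexive (@path_power_adj t n).
Proof. by move=> i; rewrite /path_power_adj distnn. Qed.

Definition path_power (t n : nat) : ordered_graph :=
  OrderedGraph (@path_power_adj_sym t n) (@path_power_adj_irr t n).

(* Only the values on two-element sets matter; true is red, false is blue. *)
Definition coloring (N : nat) := {ffun {set 'I_N} -> bool}.

Definition is_mono_copy (N : nat) (c : coloring N) (col : bool)
    (G : ordered_graph) (f : {ffun 'I_(order_of G) -> 'I_N}) : bool :=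
  [forall i : 'I_(order_of G), forall j : 'I_(order_of G),
     (i < j) ==> (f i < f j)] &&
  [forall i, forall j, @adj G i j ==> (c [set f i; f j] == col)].

Definition has_mono_copy (N : nat) (c : coloring N) (col : bool)
    (G : ordered_graph) : bool :=
  [exists f, @is_mono_copy N c col G f].

Definition arrows (N : nat) (G H : ordered_graph) : bool :=
  [forall c : coloring N, has_mono_copy c true G || has_mono_copy c false H].

(* Ramsey's theorem, needed to form the minimum in the definition of r2. *)
Lemma seq_ramsey (a b : nat) :
  exists N, forall (c : rel nat) (s : seq nat), N <= size s ->
    exists2 u, subseq u s &
    (size u == a) && pairwise (fun x y => c x y == true) u ||
    (size u == b) && pairwise (fun x y => c x y == false) u.
Proof.
move: {-1}(a + b) (leqnn (a + b)) => k.
elim: k a b => [|k IH] [|a] [|b] le_k; rewrite ?addnS ?addSn ?ltnS in le_k => //;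
  try by exists 0 => c s _; exists [::]; rewrite ?sub0seq ?orbT.
have [|N1 H1] := IH a b.+1; first by rewrite addnS.
have [|N2 H2] := IH a.+1 b; first by rewrite addSn.
exists (N1 + N2).+1 => c [|x s] //; rewrite [size _]/= ltnS => les.
have [le1|lt1] := leqP N1 (size [seq y <- s | c x y]).
  have [u su /orP[/andP[/eqP szu pu]|hu]] := H1 c _ le1; last first.
    exists u; last by rewrite hu orbT.
    by apply: subseq_trans (subseq_trans su (filter_subseq _ _)) (subseq_cons s x).
  exists (x :: u).
    by rewrite /= eqxx; apply: subseq_trans su (filter_subseq _ _).
  rewrite /= szu eqxx pu andbT; apply/orP; left; apply/allP => y yu.
  by move: (mem_subseq su yu); rewrite mem_filter => /andP[-> _].
have le2 : N2 <= size [seq y <- s | ~~ c x y].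
  have := count_predC (c x) s; rewrite -!size_filter => e.
  rewrite -(leq_add2l N1); apply: leq_trans les _; rewrite -e leq_add2r.
  exact: ltnW.
have [u su /orP[hu|/andP[/eqP szu pu]]] := H2 c _ le2.
  exists u; last by rewrite hu.
  by apply: subseq_trans (subseq_trans su (filter_subseq _ _)) (subseq_cons s x).
exists (x :: u).
  by rewrite /= eqxx; apply: subseq_trans su (filter_subseq _ _).
rewrite /= szu eqxx pu andbT; apply/orP; right; apply/allP => y yu.
by move: (mem_subseq su yu); rewrite mem_filter => /andP[/= /negPf-> _].
Qed.

Lemma ramsey_exists (G H : ordered_graph) : exists N, arrows N G H.
Proof.
have [N HN] := seq_ramsey (order_of G) (order_of H).
exists N.+1; apply/forallP => c.
pose cn : rel nat := fun x y => c [set inord x; inord y].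
have copy u col (K : ordered_graph) : subseq u (iota 0 N.+1) ->
    size u = order_of K -> pairwise (fun x y => cn x y == col) u ->
    has_mono_copy c col K.
  move=> su szu /(pairwiseP 0) pu.
  have ltu : {in gtn (size u) &, {homo nth 0 u : i j / i < j}}.
    by apply/(sorted_ltn_nth ltn_trans 0)/(subseq_sorted ltn_trans su)/iota_ltn_sorted.
  have ltN (i : 'I_(order_of K)) : nth 0 u i < N.+1.
    have := mem_nth 0 (_ : i < size u); rewrite szu ltn_ord => /(_ isT) iu.
    by have := mem_subseq su iu; rewrite mem_iota.
  have szi (i : 'I_(order_of K)) : (i : nat) \in gtn (size u).
    by rewrite unfold_in /= szu.
  have cu (i j : 'I_(order_of K)) : i < j ->
      c [set inord (nth 0 u i); inord (nth 0 u j)] == col.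
    by move=> ij; apply: pu.
  apply/existsP; exists [ffun i : 'I_(order_of K) => inord (nth 0 u i)]; apply/andP; split;
    apply/forallP => i; apply/forallP => j; apply/implyP => ij; rewrite !ffunE.
    by rewrite !inordK //; apply: ltu.
  case: (ltngtP i j) => [|/cu|/val_inj eij]; first exact: cu.
    by rewrite finset.setUC.
  by rewrite eij adj_irr in ij.
have [|u su] := HN cn (iota 0 N.+1); first by rewrite size_iota.
case/orP => /andP[/eqP szu pu]; apply/orP; [left|right];
  exact: copy su szu pu.
Qed.

Definition r2 (G H : ordered_graph) : nat := ex_minn (ramsey_exists G H).

Definition log2 (R : realType) (x : R) : R := (ln x / ln 2)%R.

(* Main.v *)
Require Import Defs.
From HB Require Import structures.
From mathcomp Require Import all_boot all_order all_algebra.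
From mathcomp Require Import all_classical all_reals all_analysis.
From mathcomp Require Import fintype finset zify.

(** Suppose that a vertex set [V] contains no red [K_s], and put
    [D = (2s)^(t(t+1))].  If [2|V| >= D m], then there is a blue clique [M] on
    [t] vertices together with sets [L < M < R] of size at least [m], every
    vertex of which is joined to all of [M] in blue.  Blue copies of
    [P_(n/2)^t] in [L] and in [R] are then linked through [M] into a blue copy
    of [P_n^t], since vertices on different sides of [M] are more than [t]
    apart.  So [D^k <= 2|V|] suffices for every [n < 2^(k+1)].

    To find [M], note that fewer than [s d] vertices have fewer than [d] blue
    neighbours to their right: a greedy choice from left to right would produce
    a red [K_s].  Hence most vertices [v] have [E] chosen blue neighbours on
    each side.  For [x < y], let [S_xy] be the set of those [v] for which [x]
    is a chosen left and [y] a chosen right neighbour.  The same greedy bound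
    shows that [S_xy] contains at least [(|S_xy| - (s-1)d) C] blue [t]-cliques,
    where [C] bounds the number of blue [(t-1)]-cliques in any [d]-set.  This is
    linear in [|S_xy|], so it can be summed over all pairs [(x, y)], and some
    [t]-clique [M] lies in so many [S_xy] that its sets of common chosen
    neighbours, of size at most [E], must both have size at least [m]. *)

Set Implicit Arguments.
Unset Strict Implicit.
Unset Printing Implicit Defensive.

Local Open Scope nat_scope.

(** * Cliques, independent sets and small upper degrees *)

Definition clique (T : finType) (e : rel T) (A : {set T}) :=
  [forall x in A, forall y in A, (x != y) ==> e x y].

(** For the blue graph [e] and [k = s.-1]: the absence of a red [K_s] in [V]. *)
Definition indep_bound (T : finType) (e : rel T) (k : nat) (V : {set T}) :=
  forall A : {set T},
    A \subset V -> clique (fun x y => ~~ e x y) A -> #|A| <= k.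

(** [h] encodes the vertex order; an order-reversing [h'] turns right neighbourhoods into left ones,
    so the same lemmas serve both sides. *)
Definition upper_nbhd (T : finType) (h : T -> nat) (e : rel T) (V : {set T})
    (v : T) : {set T} :=
  [set w in V | (h v < h w) && e v w].

Definition cliques (T : finType) (e : rel T) (q : nat) (V : {set T}) :=
  [set M : {set T} | [&& M \subset V, #|M| == q & clique e M]].

Lemma cliqueP (T : finType) (e : rel T) (A : {set T}) :
  reflect {in A &, forall x y, x != y -> e x y} (clique e A).
Proof.
apply: (iffP forall_inP) => H.
  by move=> x y xA yA xy; move/forall_inP: (H x xA) => /(_ y yA) /implyP; apply.
by move=> x xA; apply/forall_inP => y yA; apply/implyP; apply: H.
Qed.

Lemma cliqueU1 (T : finType) (e : rel T) (v : T) (A : {set T}) :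
  symmetric e -> {in A, forall w, e v w} -> clique e A -> clique e (v |: A).
Proof.
move=> esym ev /cliqueP cA; apply/cliqueP => x y.
rewrite !inE => /orP[/eqP->|xA] /orP[/eqP->|yA]; rewrite ?eqxx // => xy.
- exact: ev.
- by rewrite esym; exact: ev.
- exact: cA.
Qed.

Lemma indep_boundS (T : finType) (e : rel T) (k : nat) (U V : {set T}) :
  U \subset V -> indep_bound e k V -> indep_bound e k U.
Proof. by move=> UV H A AU; apply: H; apply: subset_trans UV. Qed.

Lemma upper_nbhdS (T : finType) (h : T -> nat) (e : rel T) (V : {set T}) v :
  upper_nbhd h e V v \subset V.
Proof. by apply/subsetP => w; rewrite inE => /andP[]. Qed.

(* Repeatedly take the [h]-least vertex and discard its upper neighbours. *)
Lemma greedy_indep (T : finType) (h : T -> nat) (e : rel T) (d : nat)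
    (S : {set T}) :
  symmetric e -> injective h ->
  {in S, forall v, #|upper_nbhd h e S v| < d} ->
  exists A : {set T},
    [/\ A \subset S, clique (fun x y => ~~ e x y) A & #|S| <= #|A| * d].
Proof.
move=> esym hinj; move: {2}#|S| (leqnn #|S|) => n.
elim: n S => [|n IH] S leS Sd.
  exists set0; split; first exact: sub0set.
    by apply/cliqueP => x y; rewrite inE.
  by move: leS; rewrite leqn0 => /eqP->.
have [->|[v0 v0S]] := set_0Vmem S.
  exists set0; split; first exact: sub0set.
    by apply/cliqueP => x y; rewrite inE.
  by rewrite cards0.
case: (arg_minnP h v0S) => v /= vS' vmin; have vS : v \in S by [].
pose S' := S :\: (v |: upper_nbhd h e S v).
have S'S : S' \subset S by apply: subsetDl.
have cS : #|S| <= d + #|S'|.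
  rewrite -(cardsID (v |: upper_nbhd h e S v) S) leq_add2r.
  apply: leq_trans (subset_leq_card (subsetIr _ _)) _.
  by rewrite cardsU1; apply: leq_trans (Sd v vS); rewrite -add1n leq_add2r leq_b1.
have [||A [AS' cA leA]] := IH S'.
- have : S' \proper S.
    by apply/properP; split=> //; exists v => //; rewrite !inE eqxx.
  by move/proper_card => lt; rewrite -ltnS; apply: leq_trans leS.
- move=> w wS'; apply: leq_ltn_trans (Sd w (subsetP S'S _ wS')).
  apply: subset_leq_card; apply/subsetP => x; rewrite !inE.
  by move=> /andP[/andP[_ ->] ->].
have vA : v \notin A.
  by apply/negP => /(subsetP AS'); rewrite !inE eqxx.
exists (v |: A); split.
- by rewrite subUset sub1set vS (subset_trans AS').
- apply: cliqueU1 => // [x y|w wA]; first by rewrite esym.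
  have := subsetP AS' _ wA; rewrite !inE negb_or => /andP[/andP[wv]].
  rewrite negb_and => H wS; move: H; rewrite wS /= negb_and => /orP[|//].
  by rewrite -leqNgt leq_eqVlt (inj_eq hinj) (negbTE wv) /= ltnNge vmin //.
- by rewrite cardsU1 vA mulSn; apply: leq_trans cS _; rewrite leq_add2l.
Qed.

(** Inside the set of low vertices upper neighbourhoods only shrink, so the greedy choice applies
    there, and its independent set has size at most [k]. *)
Lemma card_low_upper_nbhd (T : finType) (h : T -> nat) (e : rel T) (k d : nat)
    (V : {set T}) :
  symmetric e -> injective h -> indep_bound e k V ->
  #|[set v in V | #|upper_nbhd h e V v| < d]| <= k * d.
Proof.
move=> esym hinj Vk; set S := [set v in V | _].
have SV : S \subset V by apply/subsetP => v; rewrite inE => /andP[].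
have [|A [AS cA leA]] := @greedy_indep T h e d S esym hinj.
  move=> v; rewrite inE => /andP[vV]; apply: leq_ltn_trans.
  apply: subset_leq_card; apply/subsetP => x; rewrite !inE.
  by move=> /andP[/andP[-> _] ->].
by apply: leq_trans leA _; rewrite leq_mul2r Vk ?orbT // (subset_trans AS).
Qed.

(** * Lower bounds on the number of cliques *)

(** Adding [v] to a clique above it is injective: [v] is recovered as the least vertex of the
    union. *)
Lemma cliquesS_lb (T : finType) (h : T -> nat) (e : rel T) (q : nat)
    (V : {set T}) :
  symmetric e ->
  \sum_(v in V) #|cliques e q (upper_nbhd h e V v)| <= #|cliques e q.+1 V|.
Proof.
move=> esym.
pose X := [set p : T * {set T} |
  (p.1 \in V) && (p.2 \in cliques e q (upper_nbhd h e V p.1))].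
have -> : \sum_(v in V) #|cliques e q (upper_nbhd h e V v)| = #|X|.
  under eq_bigr do rewrite -sum1_card.
  rewrite pair_big_dep /= -sum1_card; apply: eq_bigl => -[v M] /=.
  by rewrite [in RHS]inE.
have XP p : p \in X -> [/\ p.1 \in V, p.2 \subset upper_nbhd h e V p.1,
    #|p.2| = q, clique e p.2 & forall w, w \in p.2 -> h p.1 < h w].
  rewrite !inE => /andP[-> /and3P[sub /eqP-> ->]]; split=> // w.
  by move/(subsetP sub); rewrite inE => /and3P[].
have notin p : p \in X -> p.1 \notin p.2.
  by move=> /XP[_ _ _ _ lt]; apply/negP => /lt; rewrite ltnn.
rewrite -(@card_in_imset _ _ (fun p : T * {set T} => p.1 |: p.2) (mem X)).
  apply: subset_leq_card; apply/subsetP => M /imsetP[p pX ->].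
  have [pV sub cq cl _] := XP p pX.
  rewrite inE subUset sub1set pV (subset_trans sub (upper_nbhdS _ _ _ _)).
  rewrite cardsU1 (notin p pX) cq eqxx /= cliqueU1 // => w.
  by move/(subsetP sub); rewrite inE => /and3P[].
move=> p p' pX p'X E.
have [_ _ _ _ lt] := XP p pX; have [_ _ _ _ lt'] := XP p' p'X.
have E1 : p.1 = p'.1.
  have : p.1 \in p'.1 |: p'.2 by rewrite -E setU11.
  have : p'.1 \in p.1 |: p.2 by rewrite E setU11.
  rewrite !inE => /orP[/eqP->//|/lt l1] /orP[/eqP->//|/lt' l2].
  by have := ltn_trans l1 l2; rewrite ltnn.
have : (p.1 |: p.2) :\ p.1 = (p'.1 |: p'.2) :\ p'.1 by rewrite E E1.
rewrite !setU1K ?notin // => E2.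
by case: p p' E1 E2 {pX p'X E lt lt'} => [? ?] [? ?] /= -> ->.
Qed.

(** All but [k * d] vertices are the least vertex of at least [K / c] cliques. With the fraction
    cleared and the loss on the right, the bound is linear in [#|V|] and holds for small [V] too. *)
Lemma card_cliques_recl (T : finType) (h : T -> nat) (e : rel T)
    (k d q c K : nat) (V : {set T}) :
  symmetric e -> injective h -> indep_bound e k V ->
  (forall U : {set T}, U \subset V -> d <= #|U| ->
     K <= c * #|cliques e q U|) ->
  #|V| * K <= c * #|cliques e q.+1 V| + k * d * K.
Proof.
move=> esym hinj Vk HK.
have low := card_low_upper_nbhd d esym hinj Vk.
set S := [set v in V | _] in low.
have lb : c * (\sum_(v in V) #|cliques e q (upper_nbhd h e V v)|)
    <= c * #|cliques e q.+1 V|.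
  by rewrite leq_mul2l cliquesS_lb ?orbT.
apply: leq_trans (leq_add lb (leq_mul low (leqnn K))).
rewrite -{1}(cardsID S V) mulnDl addnC; apply: leq_add; last first.
  by rewrite leq_mul2r subset_leq_card ?orbT ?subsetIr.
rewrite -sum_nat_const big_distrr /= [leqRHS](big_setID S) /= addnC.
apply: leq_trans (leq_addr _ _).
apply: leq_sum => v; rewrite !inE => /andP[H vV].
apply: HK; first exact: upper_nbhdS.
by move: H; rewrite vV /= -leqNgt.
Qed.

(** Take [d = (2 * s) ^ q * f] in the recursion: as [#|V| >= 2 * s * d], fewer than half of the
    vertices are lost at each step, whence [2 ^ q]. The sizes [(2 * s) ^ i * f] for [i <= q]
    multiply to the left-hand side. *)
Lemma card_cliques_lb (T : finType) (h : T -> nat) (e : rel T) (s f q : nat)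
    (V : {set T}) :
  symmetric e -> injective h -> indep_bound e s.-1 V -> 0 < s ->
  (2 * s) ^ q * f <= #|V| ->
  f ^ q.+1 * (2 * s) ^ 'C(q.+1, 2) <= 2 ^ q * #|cliques e q.+1 V|.
Proof.
move=> esym hinj Vk s0; elim: q V Vk => [|q IH] V Vk leV.
  rewrite bin_small // !muln1 mul1n; move: leV; rewrite mul1n => leV.
  apply: leq_trans leV _.
  have -> : #|V| = #|[set [set x] | x in V]|.
    by rewrite card_imset //; exact: set1_inj.
  apply: subset_leq_card; apply/subsetP => M /imsetP[x xV ->].
  rewrite inE sub1set xV cards1 eqxx /=; apply/cliqueP => a b.
  by rewrite !inE => /eqP-> /eqP->; rewrite eqxx.
have := card_cliques_recl esym hinj Vk
  (fun U UV leU => IH U (indep_boundS UV Vk) leU).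
rewrite (binS q.+1) bin1 expnD [f ^ q.+2]expnS [2 ^ q.+1]expnS.
move: leV; rewrite [(2 * s) ^ q.+1]expnS.
move: (f ^ q.+1) (_ ^ 'C(_, _)) ((2 * s) ^ q) (2 ^ q) #|_| #|cliques e _ V| => F u U c v w.
case: s s0 {Vk IH} => // s _; rewrite [s.+1.-1]/= => leV rec.
have {}leV : 2 * s.+1 * (U * f * (F * u)) <= v * (F * u).
  by rewrite mulnA leq_mul2r [2 * _ * (U * f)]mulnA leV orbT.
rewrite (_ : f * F * _ = 2 * s.+1 * (U * f * (F * u))); last by lia.
move: leV rec; rewrite -(mulnA s); move: (U * f * _) (v * _) => Z y; lia.
Qed.

(** * Trimming sets and double counting *)

(** Trimming gives each good vertex exactly [E] chosen neighbours per side, and [V] the exact size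
    for which the final inequality is checked. *)
Definition take_set (T : finType) (n : nat) (A : {set T}) : {set T} :=
  [set x in take n (enum A)].

Lemma take_set_sub (T : finType) (n : nat) (A : {set T}) :
  take_set n A \subset A.
Proof. by apply/subsetP => x; rewrite inE => /mem_take; rewrite mem_enum. Qed.

Lemma card_take_set (T : finType) (n : nat) (A : {set T}) :
  #|take_set n A| = minn n #|A|.
Proof.
rewrite cardsE (card_uniqP _) ?take_uniq ?enum_uniq //.
by rewrite size_take_min -cardE.
Qed.

Lemma card_cliques_ub (T : finType) (e : rel T) (q : nat) (V : {set T}) :
  #|cliques e q V| <= 'C(#|V|, q).
Proof.
rewrite -cards_draws; apply: subset_leq_card; apply/subsetP => M.
by rewrite !inE => /and3P[-> ->].
Qed.

Lemma exchange_card (I J : finType) (P : {set I}) (Q : {set J})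
    (r : I -> J -> bool) :
  \sum_(i in P) #|[set j in Q | r i j]| = \sum_(j in Q) #|[set i in P | r i j]|.
Proof.
have E (K : finType) (A : {set K}) (b : pred K) :
    #|[set k in A | b k]| = \sum_(k in A) b k.
  by rewrite cardsE -sum1_card big_mkcondr.
under eq_bigr do rewrite E.
by rewrite exchange_big; under [in RHS]eq_bigr do rewrite E.
Qed.

Lemma card_increasing_pairs (T : finType) (h : T -> nat) (V : {set T}) :
  #|[set p : T * T | [&& p.1 \in V, p.2 \in V & h p.1 < h p.2]]|
    <= 'C(#|V|, 2).
Proof.
rewrite -cards_draws; set P := [set p | _].
have PP p : p \in P -> [/\ p.1 \in V, p.2 \in V & h p.1 < h p.2].
  by rewrite inE => /and3P[].
rewrite -(@card_in_imset _ _ (fun p : T * T => [set p.1; p.2]) (mem P)).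
  apply: subset_leq_card; apply/subsetP => M /imsetP[p /PP[p1 p2 lt] ->].
  rewrite inE subUset !sub1set p1 p2 cards2.
  by rewrite (_ : p.1 != p.2) //; apply: contraTneq lt => ->; rewrite ltnn.
move=> [a b] [a' b'] /PP[/= _ _ lt] /PP[/= _ _ lt'] E.
have : a \in [set a'; b'] by rewrite -E set21.
have : b \in [set a'; b'] by rewrite -E set22.
have : a' \in [set a; b] by rewrite E set21.
rewrite !inE => /orP[]/eqP ea /orP[]/eqP eb /orP[]/eqP ec; subst => //.
all: by move: lt lt'; rewrite ?ltnn // => /ltnW; rewrite leqNgt => /negbTE->.
Qed.

Lemma card_good_vertices (T : finType) (h h' : T -> nat) (e : rel T)
    (k E : nat) (V : {set T}) :
  symmetric e -> injective h -> injective h' -> indep_bound e k V ->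
  #|V| <= #|[set v in V | (E <= #|upper_nbhd h' e V v|) &&
                          (E <= #|upper_nbhd h e V v|)]| + 2 * (k * E).
Proof.
move=> esym hinj h'inj Vk; set G := [set v in V | _].
have low' := card_low_upper_nbhd E esym h'inj Vk.
have low := card_low_upper_nbhd E esym hinj Vk.
have cover : V \subset G :|: ([set v in V | #|upper_nbhd h' e V v| < E] :|:
                              [set v in V | #|upper_nbhd h e V v| < E]).
  apply/subsetP => v vV; rewrite !inE vV /=.
  by case: (leqP E); case: (leqP E).
apply: leq_trans (subset_leq_card cover) _.
apply: leq_trans (leq_card_setU _ _) _; rewrite leq_add2l mul2n -addnn.
by apply: leq_trans (leq_card_setU _ _) _; exact: leq_add.
Qed.

(** * Existence of the middle clique *)

(** Pairs [(p, M)] with [M] a clique inside [S p] are counted in two ways. The last hypothesis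
    contradicts the upper bound that holds when no [M] has at least [m] common chosen neighbours on
    both sides. *)
Lemma middle_clique_of_count (T : finType) (h h' : T -> nat) (e : rel T)
    (k m d E t c K : nat) (V : {set T}) :
  symmetric e -> injective h -> (forall x y, (h' x < h' y) = (h y < h x)) ->
  indep_bound e k V ->
  (forall U : {set T}, U \subset V -> d <= #|U| ->
     K <= c * #|cliques e t U|) ->
  c * ('C(#|V|, t.+1) * (m.-1 * E)) + 'C(#|V|, 2) * (k * d * K)
    < (#|V| - 2 * (k * E)) * (E * E) * K ->
  exists M L R : {set T},
    [/\ M \in cliques e t.+1 V,
        {in M, forall v, L \subset upper_nbhd h' e V v},
        {in M, forall v, R \subset upper_nbhd h e V v} &
        m <= #|L| /\ m <= #|R|].
Proof.
move=> esym hinj h'E Vk HK ineq.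
have h'inj : injective h'.
  by move=> x y exy; apply: hinj; have := h'E x y; have := h'E y x; rewrite exy; lia.
have := card_good_vertices E esym hinj h'inj Vk; set G := [set v in V | _] => cG.
pose L' v := take_set E (upper_nbhd h' e V v).
pose R' v := take_set E (upper_nbhd h e V v).
pose P := [set p : T * T | [&& p.1 \in V, p.2 \in V & h p.1 < h p.2]].
pose S p := [set v in G | (p.1 \in L' v) && (p.2 \in R' v)].
have SV p : S p \subset V.
  by apply/subsetP => v; rewrite !inE => /andP[/andP[]].
pose LM (M : {set T}) := [set x | [forall v in M, x \in L' v]].
pose RM (M : {set T}) := [set x | [forall v in M, x \in R' v]].
have [/existsP[M /and3P[Mcl mL mR]]|/existsPn none] := boolP
    [exists M : {set T}, [&& M \in cliques e t.+1 V, m <= #|LM M| & m <= #|RM M|]].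
  exists M, (LM M), (RM M); split=> // v vM; apply/subsetP => x; rewrite inE;
    by move/forall_inP => /(_ v vM); apply/subsetP; apply: take_set_sub.
(* A good [v] lies in [S (x, y)] for all [E * E] choices of [x] in [L' v] and [y] in [R' v]. *)
have W : #|G| * (E * E) <= \sum_(p in P) #|S p|.
  rewrite exchange_card -sum_nat_const; apply: leq_sum => v.
  rewrite inE => /and3P[vV EL ER].
  have cL : #|L' v| = E by rewrite card_take_set; apply/minn_idPl.
  have cR : #|R' v| = E by rewrite card_take_set; apply/minn_idPl.
  rewrite -{1}cL -{1}cR -cardsX; apply: subset_leq_card.
  apply/subsetP => -[x y] /setXP[xL yR].
  have /setIdP[xV /andP[hx _]] : x \in upper_nbhd h' e V v.
    exact: subsetP (take_set_sub _ _) _ xL.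
  have /setIdP[yV /andP[hy _]] : y \in upper_nbhd h e V v.
    exact: subsetP (take_set_sub _ _) _ yR.
  apply/setIdP; split; last by apply/andP.
  by rewrite inE /= xV yV; apply: ltn_trans hy; rewrite -h'E.
have lb : (\sum_(p in P) #|S p|) * K <=
    c * (\sum_(p in P) #|cliques e t.+1 (S p)|) + #|P| * (k * d * K).
  rewrite big_distrl big_distrr /= -sum_nat_const -big_split /=.
  apply: leq_sum => p _; apply: (card_cliques_recl esym hinj).
    exact: indep_boundS (SV p) Vk.
  by move=> U US; apply: HK; apply: subset_trans (SV p).
(* If [M] lies in [S (x, y)], then [x] is in [LM M] and [y] in [RM M]; one of these has at most
   [m.-1] elements, the other at most [E]. *)
have ub : \sum_(p in P) #|cliques e t.+1 (S p)|
    <= 'C(#|V|, t.+1) * (m.-1 * E).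
  apply: leq_trans
    (_ : \sum_(p in P) #|[set M in cliques e t.+1 V | M \subset S p]| <= _).
    apply: leq_sum => p _; apply: subset_leq_card; apply/subsetP => M.
    rewrite !inE => /and3P[sub -> ->].
    by rewrite sub (subset_trans sub (SV p)).
  rewrite exchange_card; apply: leq_trans
    (_ : #|cliques e t.+1 V| * (m.-1 * E) <= _); last first.
    by rewrite leq_mul2r card_cliques_ub orbT.
  rewrite -sum_nat_const; apply: leq_sum => M Mcl.
  apply: leq_trans (_ : #|setX (LM M) (RM M)| <= _).
    apply: subset_leq_card; apply/subsetP => -[x y] /setIdP[_ /subsetP sub].
    by apply/setXP; split; rewrite inE; apply/forall_inP => v /sub /setIdP[_ /andP[]].
  (* For empty [M], [LM M] and [RM M] would be the whole vertex type. *)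
  have [v vM] : exists v, v \in M.
    by apply/set0Pn; rewrite -card_gt0; move: Mcl; rewrite inE => /and3P[_ /eqP->].
  have leL : #|LM M| <= E.
    apply: leq_trans (_ : #|L' v| <= _); last by rewrite card_take_set geq_minl.
    by apply: subset_leq_card; apply/subsetP => x; rewrite inE => /forall_inP; apply.
  have leR : #|RM M| <= E.
    apply: leq_trans (_ : #|R' v| <= _); last by rewrite card_take_set geq_minl.
    by apply: subset_leq_card; apply/subsetP => x; rewrite inE => /forall_inP; apply.
  rewrite cardsX; have := none M; rewrite Mcl /= negb_and -!ltnNge => /orP[] lt.
    by apply: leq_mul => //; rewrite -ltnS (ltn_predK lt).
  by rewrite mulnC; apply: leq_mul => //; rewrite -ltnS (ltn_predK lt).
have cP := card_increasing_pairs h V; rewrite -/P in cP.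
have cG' : #|V| - 2 * (k * E) <= #|G| by rewrite leq_subLR addnC.
move: ineq; rewrite ltnNge => /negP[].
apply: leq_trans (leq_add (leq_mul (leqnn c) ub) (leq_mul cP (leqnn _))).
apply: leq_trans lb; rewrite leq_mul2r; apply/orP; right.
by apply: leq_trans W; rewrite leq_mul2r cG' orbT.
Qed.

(** * Numerical estimates *)

Lemma leq_ffact_exp (n q : nat) : n ^_ q <= n ^ q.
Proof.
by elim: q => // q IH; rewrite ffactnSr expnSr leq_mul // leq_subr.
Qed.

Lemma leq_double_bin (n q : nat) : 2 * 'C(n, q.+2) <= n ^ q.+2.
Proof.
apply: leq_trans (leq_ffact_exp n q.+2); rewrite -bin_ffact mulnC leq_mul2l.
by rewrite !factS; have := fact_gt0 q; move: q`! => z; nia.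
Qed.

(** Here [(s + 3) * s >= 8] and [2 * s >= 4], and twice the exponent on the right is
    [q * (q + 3) >= 3 * q]. *)
Lemma middle_exponent (s q : nat) : 1 < s ->
  2 ^ (3 * q).+3 <= (s + 3) * s * (2 * s) ^ (q + 'C(q.+1, 2)).
Proof.
move=> s1.
have -> : 2 ^ (3 * q).+3 = 8 * 2 ^ (3 * q) by rewrite !expnS; lia.
apply: leq_mul; first by nia.
apply: leq_trans (_ : 4 ^ (q + 'C(q.+1, 2)) <= _); last first.
  case: (posnP (q + 'C(q.+1, 2))) => [->//|pos]; rewrite leq_exp2r //; lia.
rewrite -[4]/(2 ^ 2) -expnM leq_exp2l //.
have : 2 * 'C(q.+1, 2) = q.+1 * q by rewrite -mul_bin_diag bin1.
lia.
Qed.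

(* The choice [N = 32 s^3 d = D m / 2], with [D = (2s)^((q+2)(q+3))] for [t = q+2],
   makes all divisions exact; the inequality reduces to [middle_exponent]. *)
Lemma middle_numeric (s q m u f d E N K : nat) :
  1 < s -> 0 < m -> u = 2 * s -> f = s ^ 3 * u ^ (q * (q + 4)) * m ->
  d = u ^ q * f -> E = 8 * s ^ 2 * d -> N = 32 * s ^ 3 * d ->
  K = f ^ q.+1 * u ^ 'C(q.+1, 2) ->
  2 ^ q * ('C(N, q.+2) * (m.-1 * E)) + 'C(N, 2) * (s.-1 * d * K)
    < (N - 2 * (s.-1 * E)) * (E * E) * K.
Proof.
move=> s1 m0 uE fE dE EE NE KE.
have s0 : 0 < s by lia.
have u0 : 0 < u by lia.
have f0 : 0 < f by rewrite fE !muln_gt0 ?expn_gt0 m0 u0 s0.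
have d0 : 0 < d by rewrite dE !muln_gt0 ?expn_gt0 f0 u0.
have N0 : 0 < N by rewrite NE !muln_gt0 ?expn_gt0 d0 s0.
(* This is the doubled inequality divided by [N ^ 2 * d]: its right-hand side becomes
   [2 * s.+1 * K], the error term is at most [s.-1 * K], and the difference is [(s + 3) * K]. *)
have key : 2 ^ q * N ^ q * (8 * s ^ 2 * m.-1) < (s + 3) * K.
  have -> : N = 4 * u ^ (q + 3) * f.
    have u3 : u ^ 3 = 8 * s ^ 3 by rewrite uE expnMn.
    by rewrite NE dE expnD u3; move: (s ^ 3) (u ^ q) => a b; lia.
  have p2 : 2 ^ (3 * q).+3 = 8 * (2 ^ q * 4 ^ q).
    rewrite -[4]/(2 ^ 2) -expnM -expnD (_ : q + 2 * q = 3 * q); last by lia.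
    by rewrite !expnS; move: (2 ^ _) => a; lia.
  have := middle_exponent q s1; rewrite -uE p2.
  have s3 : s ^ 3 = s * s ^ 2 by rewrite expnS.
  rewrite !expnMn -!expnM KE (expnSr f) [X in f ^ q * X]fE s3.
  rewrite (_ : q * (q + 4) = (q + 3) * q + q); last by lia.
  rewrite (expnD u q) (expnD u _ q).
  have : 0 < f ^ q * (u ^ ((q + 3) * q) * s ^ 2) * (8 * (2 ^ q * 4 ^ q)).
    by rewrite !muln_gt0 ?expn_gt0 f0 u0 s0.
  move: (2 ^ q) (4 ^ q) (f ^ q) (u ^ ((q + 3) * q)) => a a' b c.
  move: (u ^ q) (u ^ 'C(q.+1, 2)) (s ^ 2) => x y z pos le.
  have := leq_mul (leqnn (b * (c * z) * m)) le; case: m m0 {fE} => // m _.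
  rewrite [m.+1.-1]/=; lia.
have bN := leq_double_bin N q; have bN2 := leq_double_bin N 0.
have s3 : s ^ 3 = s * s ^ 2 by rewrite expnS.
have NkE : N - 2 * (s.-1 * E) = 16 * s ^ 2 * s.+1 * d.
  rewrite NE EE s3; move: (s ^ 2) => z.
  by case: s s0 {s1 uE fE EE NE key s3} => // s _; rewrite [s.+1.-1]/=; nia.
rewrite -(ltn_pmul2l (isT : 0 < 2)) NkE.
apply: leq_ltn_trans
  (_ : 2 ^ q * (N ^ q.+2 * (m.-1 * E)) + N ^ 2 * (s.-1 * d * K) < _).
  rewrite mulnDr; apply: leq_add; last by rewrite mulnA leq_mul2r bN2 orbT.
  rewrite mulnCA leq_mul2l; apply/orP; right.
  by rewrite mulnA leq_mul2r bN orbT.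
have := key; rewrite -(ltn_pmul2l (_ : 0 < N * N * d)); last first.
  by rewrite !muln_gt0 d0 N0.
rewrite (_ : N ^ q.+2 = N * N * N ^ q); last by rewrite !expnS mulnA.
have NN : N * N = 1024 * s ^ 2 * s ^ 2 * s ^ 2 * d * d.
  by rewrite NE s3 -!mulnn; lia.
rewrite -(mulnn N) NN EE; move: (N ^ q) (2 ^ q) (s ^ 2) => x y z.
case: s s0 {s1 uE fE EE NE NkE key bN bN2 s3 NN} => // s _; rewrite [s.+1.-1]/=.
by move: (m.-1) => p; lia.
Qed.

Lemma upper_nbhd_mono (T : finType) (h : T -> nat) (e : rel T)
    (U V : {set T}) v :
  U \subset V -> upper_nbhd h e U v \subset upper_nbhd h e V v.
Proof.
move=> /subsetP UV; apply/subsetP => w; rewrite !inE => /andP[wU ->].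
by rewrite UV.
Qed.

Lemma cliques_mono (T : finType) (e : rel T) q (U V : {set T}) :
  U \subset V -> cliques e q U \subset cliques e q V.
Proof.
move=> UV; apply/subsetP => M; rewrite !inE => /and3P[MU -> ->].
by rewrite (subset_trans MU).
Qed.

Lemma exists_middle_clique (T : finType) (h h' : T -> nat) (e : rel T)
    (s t m : nat) (V : {set T}) :
  symmetric e -> injective h -> (forall x y, (h' x < h' y) = (h y < h x)) ->
  1 < s -> 0 < t -> 0 < m -> indep_bound e s.-1 V ->
  (2 * s) ^ (t * t.+1) * m <= 2 * #|V| ->
  exists M L R : {set T},
    [/\ M \in cliques e t V,
        {in M, forall v, L \subset upper_nbhd h' e V v},
        {in M, forall v, R \subset upper_nbhd h e V v} &
        m <= #|L| /\ m <= #|R|].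
Proof.
move=> esym hinj h'E s1 t0 m0 Vk.
case: t t0 => [//|[|q]] _ leV.
  (* For [t = 1] one good vertex is enough; it exists as
     [#|V| >= 2 * s ^ 2 * m > 2 * (s.-1 * m)]. *)
  have h'inj : injective h'.
    by move=> x y exy; apply: hinj; have := h'E x y; have := h'E y x; rewrite exy; lia.
  have := card_good_vertices m esym hinj h'inj Vk.
  set G := [set v in V | _] => cG.
  have /set0Pn[v] : G != set0.
    rewrite -card_gt0; move: leV cG; rewrite -mulnn; move: #|V| #|G| => x y.
    by case: s s1 {Vk} => // s s1; rewrite [s.+1.-1]/=; nia.
  rewrite inE => /and3P[vV mL mR].
  exists [set v], (upper_nbhd h' e V v), (upper_nbhd h e V v); split=> //.
  - rewrite inE sub1set vV cards1 eqxx /=; apply/cliqueP => a b.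
    by rewrite !inE => /eqP-> /eqP->; rewrite eqxx.
  - by move=> w /set1P->.
  - by move=> w /set1P->.
(* Now [t = q + 2]. From size [d] on, [card_cliques_lb] counts [q.+1]-cliques. The value
   [8 * s ^ 2 * d] used for [E] is [N / (4 * s)], so more than half of the vertices are good. *)
pose u := 2 * s; pose f := s ^ 3 * u ^ (q * (q + 4)) * m.
pose d := u ^ q * f; pose N := 32 * s ^ 3 * d.
have leN : N <= #|V|.
  rewrite -(leq_pmul2l (isT : 0 < 2)); apply: leq_trans leV; rewrite -/u.
  have -> : q.+2 * q.+3 = q * (q + 4) + q + 6 by lia.
  rewrite !expnD (_ : u ^ 6 = 64 * s ^ 3 * s ^ 3).
    by rewrite /N /d /f; move: (u ^ q) (u ^ _) (s ^ 3) => a b c; lia.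
  by rewrite /u expnMn -mulnA -expnD.
have cV : #|take_set N V| = N by rewrite card_take_set; apply/minn_idPl.
have sV := take_set_sub N V.
have Vk' := indep_boundS sV Vk.
have [||M [L [R [Mcl HL HR sz]]]] := @middle_clique_of_count T h h' e s.-1 m d
    (8 * s ^ 2 * d) q.+1 (2 ^ q) (f ^ q.+1 * u ^ 'C(q.+1, 2)) (take_set N V)
    esym hinj h'E Vk'.
- move=> U UV leU; apply: (card_cliques_lb esym hinj _ _ leU); last by lia.
  exact: indep_boundS UV Vk'.
- by rewrite cV; apply: (@middle_numeric s q m u f d).
exists M, L, R; split=> //.
- exact: subsetP (cliques_mono _ _ sV) _ Mcl.
- by move=> v vM; apply: subset_trans (HL v vM) (upper_nbhd_mono _ _ _ sV).
- by move=> v vM; apply: subset_trans (HR v vM) (upper_nbhd_mono _ _ _ sV).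
Qed.

(** * Powers of paths as sequences *)

(** A copy is kept as the sequence of its vertices, ready for concatenation and truncation; [x0] is
    the default of [nth]. *)
Definition is_power_path (T : Type) (h : T -> nat) (e : rel T) (t : nat)
    (x0 : T) (u : seq T) :=
  forall i j, i < j < size u ->
    h (nth x0 u i) < h (nth x0 u j) /\
    (j <= i + t -> e (nth x0 u i) (nth x0 u j)).

Lemma increasing_enum (T : finType) (h : T -> nat) (x0 : T) (M : {set T}) :
  injective h ->
  exists w : seq T, [/\ size w = #|M|, w =i M &
    forall i j, i < j < size w -> h (nth x0 w i) < h (nth x0 w j)].
Proof.
move=> hinj; pose w := sort (relpre h leq) (enum M).
exists w; split; first by rewrite size_sort cardE.
  by move=> x; rewrite mem_sort mem_enum.
have sw : sorted ltn (map h w).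
  rewrite ltn_sorted_uniq_leq map_inj_uniq // sort_uniq enum_uniq sorted_map.
  by apply: sort_sorted => x y; apply: leq_total.
move=> i j /andP[ij jw]; have iw := ltn_trans ij jw.
rewrite -!(nth_map x0 0) //.
by apply: (sorted_ltn_nth ltn_trans) => //; rewrite inE size_map.
Qed.

(** Positions in [u1] and [u2] differ by more than [size w = t], so no edge is required between
    them; their heights are compared through the first vertex of [w], which exists as [t > 0]. *)
Lemma power_path_cat (T : eqType) (h : T -> nat) (e : rel T) (t : nat)
    (x0 : T) (u1 w u2 : seq T) :
  0 < t -> size w = t ->
  is_power_path h e t x0 u1 -> is_power_path h e t x0 w ->
  is_power_path h e t x0 u2 ->
  {in u1 & w, forall x y, h x < h y /\ e x y} ->
  {in w & u2, forall x y, h x < h y /\ e x y} ->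
  is_power_path h e t x0 (u1 ++ w ++ u2).
Proof.
move=> t0 sw p1 pw p2 h1 h2 i j; rewrite !size_cat sw !nth_cat sw.
set a := size u1; set b := size u2 => /andP[ij jlt].
have in1 k : k < a -> nth x0 u1 k \in u1 by move=> ?; apply: mem_nth.
have inw k : k < t -> nth x0 w k \in w by move=> ?; apply: mem_nth; rewrite sw.
have in2 k : k < b -> nth x0 u2 k \in u2 by move=> ?; apply: mem_nth.
case: (ltnP i a) => ia; case: (ltnP j a) => ja; try by lia.
- by apply: p1; rewrite ij.
- case: (ltnP (j - a) t) => jt.
    by have [? ?] := h1 _ _ (in1 _ ia) (inw _ jt).
  have jb : j - a - t < b by lia.
  have [l1 _] := h1 _ _ (in1 _ ia) (inw _ t0).
  have [l2 _] := h2 _ _ (inw _ t0) (in2 _ jb).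
  by split; [exact: ltn_trans l2 | lia].
case: (ltnP (i - a) t) => it; case: (ltnP (j - a) t) => jt; try by lia.
- have [|l1 l2] := pw (i - a) (j - a); first by lia.
  by split=> // jit; apply: l2; lia.
- have jb : j - a - t < b by lia.
  by have [? ?] := h2 _ _ (inw _ it) (in2 _ jb).
- have [|l1 l2] := p2 (i - a - t) (j - a - t); first by lia.
  by split=> // jit; apply: l2; lia.
Qed.

Lemma power_path_take (T : Type) (h : T -> nat) (e : rel T) (t n : nat)
    (x0 : T) (u : seq T) :
  is_power_path h e t x0 u -> is_power_path h e t x0 (take n u).
Proof.
move=> pu i j; rewrite size_take_min => /andP[ij jlt].
by rewrite !nth_take; [apply: pu | |]; lia.
Qed.

(** Induction on [k], halving [n]: two paths on [n./2] vertices and the middle clique give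
    [2 * n./2 + t >= n] vertices, as [t > 0]. *)
Lemma exists_power_path (T : finType) (h h' : T -> nat) (e : rel T)
    (s t k n : nat) (x0 : T) (V : {set T}) :
  symmetric e -> injective h -> (forall x y, (h' x < h' y) = (h y < h x)) ->
  0 < s -> 0 < t -> indep_bound e s.-1 V ->
  ((2 * s) ^ (t * t.+1)) ^ k <= 2 * #|V| -> n < 2 ^ k.+1 ->
  exists u : seq T,
    [/\ size u = n, {subset u <= V} & is_power_path h e t x0 u].
Proof.
move=> esym hinj h'E s0 t0; set D := (2 * s) ^ _.
have D0 : 0 < D by rewrite expn_gt0; lia.
elim: k n V => [|k IH] n V Vk leV ltn.
  have /card_gt0P[x xV] : 0 < #|V| by lia.
  exists (nseq n x); split; first exact: size_nseq.
    by move=> y /nseqP[->].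
  by move=> i j; rewrite size_nseq; lia.
(* For [s = 1] the independence bound is 0, against a nonempty [V]. *)
have [s1|s1] := leqP s 1.
  have /card_gt0P[x xV] : 0 < #|V|.
    have : 0 < D ^ k.+1 by rewrite expn_gt0 D0.
    lia.
  have := Vk [set x]; rewrite sub1set xV cards1.
  suff -> : clique (fun x y => ~~ e x y) [set x] by move=> /(_ isT isT); lia.
  by apply/cliqueP => a b; rewrite !inE => /eqP-> /eqP->; rewrite eqxx.
have Dk0 : 0 < D ^ k by rewrite expn_gt0 D0.
rewrite expnS in leV.
have [M [L [R [Mcl HL HR [mL mR]]]]] :=
  exists_middle_clique esym hinj h'E s1 t0 Dk0 Vk leV.
move: Mcl; rewrite inE => /and3P[MV /eqP cM /cliqueP clM].
have /set0Pn[v vM] : M != set0 by rewrite -card_gt0 cM.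
have LV := subset_trans (HL v vM) (upper_nbhdS _ _ _ _).
have RV := subset_trans (HR v vM) (upper_nbhdS _ _ _ _).
have n2 : n./2 < 2 ^ k.+1 by move: ltn; rewrite expnS; lia.
have mL2 : D ^ k <= 2 * #|L| by lia.
have mR2 : D ^ k <= 2 * #|R| by lia.
have [u1 [su1 u1L p1]] := IH n./2 L (indep_boundS LV Vk) mL2 n2.
have [u2 [su2 u2R p2]] := IH n./2 R (indep_boundS RV Vk) mR2 n2.
have [w [sw wM incw]] := increasing_enum x0 M hinj.
rewrite cM in sw.
exists (take n (u1 ++ w ++ u2)); split.
- by rewrite size_take_min !size_cat su1 su2 sw; lia.
- move=> x /mem_take; rewrite !mem_cat => /or3P[/u1L|xw|/u2R].
  + exact: (subsetP LV).
  + by apply: (subsetP MV); rewrite -wM.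
  + exact: (subsetP RV).
apply/power_path_take/power_path_cat => //.
- move=> i j /andP[ij jw]; have lt := incw i j; rewrite ij jw in lt.
  split=> [|_]; first exact: lt.
  apply: clM; rewrite -?wM ?mem_nth ?(ltn_trans ij) //.
  by apply: contraTneq (lt isT) => ->; rewrite ltnn.
- move=> x y xu; rewrite wM => yM.
  have := subsetP (HL y yM) x (u1L x xu).
  by rewrite inE h'E esym => /and3P[].
- move=> x y; rewrite wM => xM yu.
  have := subsetP (HR x xM) y (u2R y yu).
  by rewrite inE => /and3P[].
Qed.

(** * Passage to colorings and to the Ramsey number *)

Lemma arrows_complete_path_power (N s t k n : nat) :
  0 < s -> 0 < t ->
  ((2 * s) ^ (t * t.+1)) ^ k <= 2 * N.+1 -> n < 2 ^ k.+1 ->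
  arrows N.+1 (complete s) (path_power t n).
Proof.
move=> s0 t0 leN ltn; apply/forallP => c.
have [//|nored] := boolP (has_mono_copy c true (complete s)).
(* Diagonal values of [e] are arbitrary, but cliques and upper neighbourhoods only test pairs of
   distinct vertices. *)
pose e : rel 'I_N.+1 := fun x y => ~~ c [set x; y].
have esym : symmetric e by move=> x y; rewrite /e finset.setUC.
pose h (x : 'I_N.+1) : nat := x; pose h' (x : 'I_N.+1) : nat := rev_ord x.
have hinj : injective h by exact: ord_inj.
have h'E x y : (h' x < h' y) = (h y < h x).
  by rewrite /h' /h /=; have := ltn_ord x; have := ltn_ord y; lia.
have Vk : indep_bound e s.-1 [set: 'I_N.+1].
  move=> A _ /cliqueP cA; rewrite -ltnS prednK // ltnNge; apply/negP => leA.
  move/negP: nored; apply.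
  have [w [sw wA incw]] := increasing_enum ord0 A hinj.
  have ltw (i : 'I_s) : i < size w by rewrite sw; apply: leq_trans leA.
  apply/existsP; exists [ffun i : 'I_s => nth ord0 w i]; apply/andP; split;
    apply/forallP => i; apply/forallP => j; apply/implyP => ij; rewrite !ffunE.
    by apply: incw; rewrite ij ltw.
  have := cA (nth ord0 w i) (nth ord0 w j); rewrite -!wA !mem_nth //.
  move=> /(_ isT isT) red; rewrite eqb_id -[c _]negbK; apply: red.
  have /orP[lt|lt] : (i < j) || (j < i) by rewrite -neq_ltn.
    have := incw i j; rewrite lt ltw => /(_ isT).
    by apply: contraTneq => ->; rewrite ltnn.
  have := incw j i; rewrite lt ltw => /(_ isT).
  by apply: contraTneq => ->; rewrite ltnn.
rewrite -[N.+1]card_ord -cardsT in leN.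
have [u [su _ pu]] := exists_power_path ord0 esym hinj h'E s0 t0 Vk leN ltn.
apply/existsP; exists [ffun i : 'I_n => nth ord0 u i]; apply/andP; split;
  apply/forallP => i; apply/forallP => j; apply/implyP => ij; rewrite !ffunE.
  by have [|lt _] := pu i j; first by rewrite ij su /=.
have blue (a b : 'I_n) : a < b -> path_power_adj t a b ->
    c [set nth ord0 u a; nth ord0 u b] == false.
  move=> ab /andP[_ le]; have [|_ H] := pu a b; first by rewrite ab su /=.
  by rewrite eqbF_neg; apply: H; move: le; rewrite distnEr ?(ltnW ab) //; lia.
case: (ltngtP i j) => [ij'|ji|/val_inj eij].
- exact: blue.
- by rewrite finset.setUC blue // path_power_adj_sym.
- by rewrite eij adj_irr in ij.
Qed.

Import Order.TTheory GRing.Theory Num.Theory.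

Local Open Scope ring_scope.

Unset Implicit Arguments.

Theorem theorem1p5 (R : realType) (s t n : nat) :
  (0 < s)%N -> (0 < t)%N -> (1 < n)%N ->
  (r2 (complete s) (path_power t n))%:R
    < (2 * s%:R : R) `^ (t%:R * (t%:R + 1) * log2 (n%:R : R)).
Proof.
(* The largest [k] with [2 ^ k <= n]: thus [n < 2 ^ k.+1] and [k <= log2 n]. *)
move=> s0 t0 n1; pose k := trunc_log 2 n.
(* This uses [n > 1]; for [n = 1] both sides of the claim equal 1. *)
have k0 : (0 < k)%N by rewrite trunc_log_gt0.
have n0 : (0 < n)%N := ltnW n1.
pose D := ((2 * s) ^ (t * t.+1))%N.
have D2 : (2 <= D ^ k)%N.
  rewrite -expnM (leq_trans (_ : 2 <= 2 ^ (t * t.+1 * k))%N) //.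
    by rewrite -{1}[2%N]expn1 leq_exp2l // !muln_gt0 t0.
  by rewrite leq_exp2r ?muln_gt0 ?t0 // leq_pmulr.
have r2lt : (r2 (complete s) (path_power t n) < D ^ k)%N.
  rewrite /r2; case: ex_minnP => N _ /(_ (D ^ k).-1) minN.
  (* Strictness: [D ^ k - 1] vertices suffice, since [D ^ k <= 2 * (D ^ k - 1)] when
     [D ^ k >= 2]. *)
  rewrite -(ltn_predK D2) ltnS; apply: minN.
  have -> : (D ^ k).-1 = (D ^ k).-2.+1 by lia.
  apply: (arrows_complete_path_power s0 t0 _ (trunc_log_ltn n (ltnSn 1))).
  by rewrite -/D -/k; lia.
apply: (@lt_le_trans _ _ (D ^ k)%:R); first by rewrite ltr_nat.
have u1 : 1 <= 2 * s%:R :> R by rewrite -natrM ler1n muln_gt0.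
rewrite -expnM natrX natrM -powR_mulrn; last exact: le_trans u1.
apply: ler_powR => //; rewrite !natrM -natr1 ler_wpM2l //.
have ln2 : 0 < ln 2 :> R by rewrite ln_gt0 // ltr1n.
rewrite /log2 ler_pdivlMr // mulr_natl -lnXn // ler_ln ?posrE ?exprn_gt0 ?ltr0n //.
by rewrite -natrX ler_nat trunc_logP.
Qed.
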